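(* Let $n$ be a positive integer and $h:[n]\to[n]$ a Hessenberg function. The polynomials $\check f_{h(1),1},\check f_{h(2),2},\ldots,\check f_{h(n),n}$ form a regular sequence in $\mathbb{Q}[x_1,\ldots,x_n]$.
   Context: $[n]=\{1,\ldots,n\}$. A Hessenberg function is $h:[n]\to[n]$ with $h(i)\ge i$ for all $i$ and $h(i+1)\ge h(i)$ for $i<n$. For $n\ge i\ge j\ge1$, $\check f_{i,j}:=\sum_{k=1}^{j}\big(x_k\prod_{\ell=j+1}^{i}(x_k-x_\ell)\big)\in\mathbb{Q}[x_1,\ldots,x_n]$, with the empty product equal to $1$. A sequence $\theta_1,\ldots,\theta_r$ in a ring $R$ is a regular sequence if (i) $\theta_i$ is non-zero and not a zero-divisor in $R/(\theta_1,\ldots,\theta_{i-1})$ for $i=1,\ldots,r$, and (ii) $R/(\theta_1,\ldots,\theta_r)\ne0$. *)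

(* Defs.v *)
From mathcomp Require Import all_boot all_order all_algebra.
From mathcomp Require Import mpoly.

Set Implicit Arguments.
Unset Strict Implicit.
Unset Printing Implicit Defensive.

Import GRing.Theory.
Local Open Scope ring_scope.

(* Indices are shifted by one: [n] = {1, ..., n} becomes 'I_n = {0, ..., n-1}. *)

Definition hessenberg (n : nat) (h : 'I_n -> 'I_n) : Prop :=
  (forall i : 'I_n, (i <= h i)%N) /\
  (forall i j : 'I_n, nat_of_ord j = i.+1 -> (h i <= h j)%N).

(* Only meaningful for j <= i; the shift turns 1 <= k <= j into k <= j, and
   j+1 <= l <= i into j < l <= i. *)
Definition fcheck (n : nat) (i j : 'I_n) : {mpoly rat[n]} :=
  \sum_(k < n | (k <= j)%N)
     ('X_k * \prod_(l < n | (j < l <= i)%N) ('X_k - 'X_l)).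

Section RegularSequence.

Variable R : comNzRingType.

Definition in_ideal (s : seq R) (p : R) : Prop :=
  exists c : 'I_(size s) -> R, p = \sum_(i < size s) c i * s`_i.

(* Statements about R/(s) are written in R: the class of p is zero exactly when
   p lies in the ideal (s). *)
Definition zero_divisor_mod (s : seq R) (p : R) : Prop :=
  exists q : R, ~ in_ideal s q /\ in_ideal s (p * q).

Definition regular_sequence (s : seq R) : Prop :=
  (forall i : nat, (i < size s)%N ->
     ~ in_ideal (take i s) s`_i /\ ~ zero_divisor_mod (take i s) s`_i) /\
  (* the quotient by (s) is not the zero ring *)
  (exists p : R, ~ in_ideal s p).

End RegularSequence.

(* Main.v *)
Require Import Defs.
From mathcomp Require Import all_boot all_order all_algebra.
From mathcomp Require Import mpoly.
From mathcomp Require Import ring.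

(* Induction on n, for a larger family in which x_k carries a positive weight
   c_k.  Its first member is c_1 x_1 \prod_(1 < l <= h(1)) (x_1 - x_l), a product
   of linear forms, and a sequence (ab, s) is regular as soon as (a, s) and (b, s)
   are.  So it suffices to work modulo x_1 = 0 and modulo x_1 = x_l for
   1 < l <= h(1).  In both cases the other members become a family of the same
   kind in x_2, ..., x_n: the terms of x_1 vanish when x_1 = 0, while for
   x_1 = x_l they vanish if j < l <= h(j) and merge with those of x_l, whose weight
   becomes c_l + c_1, if l <= j. *)

Set Implicit Arguments.
Unset Strict Implicit.
Unset Printing Implicit Defensive.

Import Order.TTheory GRing.Theory Num.Theory.
Local Open Scope ring_scope.

(** * Membership in finitely generated ideals *)

Lemma in_ideal_nil (R : comNzRingType) (p : R) : in_ideal [::] p <-> p = 0.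
Proof.
split; first by case=> c ->; rewrite big_ord0.
by move=> ->; exists (fun=> 0); rewrite big_ord0.
Qed.

Lemma in_ideal_cons (R : comNzRingType) (a : R) (s : seq R) (p : R) :
  in_ideal (a :: s) p <-> exists r, in_ideal s (p - r * a).
Proof.
split.
  case=> c ->; exists (c ord0), (fun i => c (lift ord0 i)).
  by rewrite big_ord_recl /= addrC addKr.
case=> r [c Ec].
exists (fun i => if unlift ord0 i is Some j then c j else r).
rewrite big_ord_recl unlift_none /= -[p in LHS](subrK (r * a)) Ec addrC.
by congr (_ + _); apply: eq_bigr => i _; rewrite liftK.
Qed.

Lemma in_ideal0 (R : comNzRingType) (s : seq R) : in_ideal s 0.
Proof. by exists (fun=> 0); rewrite big1 // => i _; rewrite mul0r. Qed.

Lemma in_idealD (R : comNzRingType) (s : seq R) (p q : R) :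
  in_ideal s p -> in_ideal s q -> in_ideal s (p + q).
Proof.
move=> [c ->] [d ->]; exists (fun i => c i + d i).
by rewrite -big_split; apply: eq_bigr => i _; rewrite mulrDl.
Qed.

Lemma in_idealMl (R : comNzRingType) (s : seq R) (r p : R) :
  in_ideal s p -> in_ideal s (r * p).
Proof.
move=> [c ->]; exists (fun i => r * c i).
by rewrite mulr_sumr; apply: eq_bigr => i _; rewrite mulrA.
Qed.

Lemma in_idealN (R : comNzRingType) (s : seq R) (p : R) :
  in_ideal s p -> in_ideal s (- p).
Proof. by rewrite -mulN1r; apply: in_idealMl. Qed.

Lemma in_ideal_consr (R : comNzRingType) (a : R) (s : seq R) (p : R) :
  in_ideal s p -> in_ideal (a :: s) p.
Proof. by move=> sp; apply/in_ideal_cons; exists 0; rewrite mul0r subr0. Qed.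

Lemma in_ideal_rcons (R : comNzRingType) (s : seq R) (a p : R) :
  in_ideal (rcons s a) p <-> exists r, in_ideal s (p - r * a).
Proof.
elim: s p => [|b s IHs] p /=; first exact: in_ideal_cons.
split.
  case/in_ideal_cons=> r /IHs[t st]; exists t; apply/in_ideal_cons; exists r.
  by rewrite addrAC.
case=> t /in_ideal_cons[r sr]; apply/in_ideal_cons; exists r; apply/IHs.
by exists t; rewrite addrAC.
Qed.

Lemma in_ideal_map (R S : comNzRingType) (f : {rmorphism R -> S})
    (s : seq R) (p : R) :
  in_ideal s p -> in_ideal (map f s) (f p).
Proof.
elim: s p => [|a s IHs] p /=.
  by move/in_ideal_nil->; rewrite rmorph0; apply: in_ideal0.
case/in_ideal_cons=> r /IHs; rewrite rmorphB rmorphM => sr.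
by apply/in_ideal_cons; exists (f r).
Qed.

(** * Weak regularity, with units allowed as entries *)

Definition weakly_regular (R : comNzRingType) (s : seq R) : Prop :=
  forall (i : nat) (q : R), (i < size s)%N ->
    in_ideal (take i s) (s`_i * q) -> in_ideal (take i s) q.

Lemma weakly_regular_sequence (R : comNzRingType) (s : seq R) :
  weakly_regular s -> (forall i, (i <= size s)%N -> ~ in_ideal (take i s) 1) ->
  regular_sequence s.
Proof.
move=> reg_s proper_s; split.
  move=> i lt_i; split; last by case=> q [sq sq']; exact/sq/reg_s.
  move=> si; apply: (proper_s i); first exact: ltnW.
  by apply: reg_s => //; rewrite mulr1.
by exists 1; rewrite -[s in in_ideal s]take_size; apply: proper_s.
Qed.

Lemma weakly_regular_head (R : comNzRingType) (a : R) (s : seq R) (q : R) :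
  weakly_regular (a :: s) -> a * q = 0 -> q = 0.
Proof.
move=> reg_as aq0; apply/in_ideal_nil; apply: (reg_as 0%N) => //=.
by rewrite aq0; apply: in_ideal0.
Qed.

(* Injectivity of the first map in the exact sequence
   [R/b -> R/ab -> R/a] modulo the first [i] elements of [s]. *)
Lemma in_ideal_cancel (R : comNzRingType) (a b : R) (s : seq R) (i : nat) (q : R) :
  weakly_regular (a :: s) -> (i <= size s)%N ->
  in_ideal (a * b :: take i s) (a * q) -> in_ideal (b :: take i s) q.
Proof.
move=> reg_as; elim: i q => [|i IHi] q le_i.
  rewrite take0 => /in_ideal_cons[r /in_ideal_nil E].
  apply/in_ideal_cons; exists r; apply/in_ideal_nil.
  by apply: (weakly_regular_head reg_as); rewrite -[RHS]E; ring.
rewrite (take_nth 0) // -!rcons_cons => /in_ideal_rcons[t].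
move=> /[dup] st /in_ideal_cons[r sr].
(* Modulo [take i s], [s]_i * t[equals]a * (q - r *
   b)[. Regularity after]a[then makes]t[a multiple]t' *
   a[, and the induction hypothesis cancels]a[from]a * (q - t' * s[_i)]. *)
have : in_ideal (a :: take i s) (s`_i * t).
  apply/in_ideal_cons; exists (q - r * b).
  have -> : s`_i * t - (q - r * b) * a = - (a * q - t * s`_i - r * (a * b)) by ring.
  exact: in_idealN.
move=> /(reg_as i.+1 t le_i) /in_ideal_cons[t' st'].
apply/in_ideal_rcons; exists t'; apply: IHi; first exact: ltnW.
have -> : a * (q - t' * s`_i) = a * q - t * s`_i + s`_i * (t - t' * a) by ring.
apply: in_idealD => //; apply: in_idealMl; exact: in_ideal_consr.
Qed.

(** If [s]_i[kills]q[modulo]a * b[, regularity after]a[gives]q = q' * a[; cancelling]a[,]s[_i] kills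
    [q'] modulo [b], so [q' = t * b] and [q = t * (a * b)], all modulo [take i s]. *)
Lemma weakly_regular_mul (R : comNzRingType) (a b : R) (s : seq R) :
  weakly_regular (a :: s) -> weakly_regular (b :: s) ->
  weakly_regular (a * b :: s).
Proof.
move=> reg_a reg_b [|i] q lt_i /=.
  move=> /in_ideal_nil; rewrite -mulrA => /(weakly_regular_head reg_a).
  by move=> /(weakly_regular_head reg_b) ->; apply: in_ideal0.
move=> /[dup] sq /in_ideal_cons[r sr].
have : in_ideal (a :: take i s) (s`_i * q).
  by apply/in_ideal_cons; exists (r * b); rewrite -mulrA [b * a]mulrC.
move=> /(reg_a i.+1 q lt_i) /in_ideal_cons[q' sq'].
have : in_ideal (b :: take i s) (s`_i * q').
  apply: (in_ideal_cancel reg_a); first exact: ltnW.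
  have -> : a * (s`_i * q') = s`_i * q - s`_i * (q - q' * a) by ring.
  apply: in_idealD => //; apply/in_idealN/in_idealMl; exact: in_ideal_consr.
move=> /(reg_b i.+1 q' lt_i) /in_ideal_cons[t st].
apply/in_ideal_cons; exists t.
have -> : q - t * (a * b) = (q - q' * a) + a * (q' - t * b) by ring.
by apply: in_idealD => //; apply: in_idealMl.
Qed.

(** A unit generates the whole ring, so later conditions are void. This serves the empty product and
    the constant weight. *)
Lemma weakly_regular_inv (R : comNzRingType) (a b : R) (s : seq R) :
  b * a = 1 -> weakly_regular (a :: s).
Proof.
move=> ba1 [|i] q lt_i /=.
  by move=> /(in_idealMl b); rewrite mulrA ba1 mul1r.
move=> _; apply/in_ideal_cons; exists (q * b).
by rewrite -mulrA ba1 mulr1 subrr; apply: in_ideal0.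
Qed.

Lemma weakly_regular_prod (R : comNzRingType) (I : finType) (P : pred I)
    (a : I -> R) (s : seq R) :
  (forall i, P i -> weakly_regular (a i :: s)) ->
  weakly_regular (\prod_(i | P i) a i :: s).
Proof.
move=> reg_a; apply: (big_ind (fun x => weakly_regular (x :: s))) => //.
  by apply: (@weakly_regular_inv _ _ 1); rewrite mulr1.
by move=> x y; apply: weakly_regular_mul.
Qed.

(** The map [f] identifies R/(u) with S, so ideal membership modulo [u] can be tested on images. *)
Lemma weakly_regular_quotient (R S : comNzRingType) (f : {rmorphism R -> S})
    (u : R) (s : seq R) :
  (forall y, exists x, f x = y) ->
  (forall p, f p = 0 <-> exists r, p = r * u) ->
  (forall q, u * q = 0 -> q = 0) ->
  weakly_regular (map f s) -> weakly_regular (u :: s).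
Proof.
move=> f_onto ker_f nzd_u reg_s.
have fu0 : f u = 0 by apply/ker_f; exists 1; rewrite mul1r.
have lift_ideal t p : in_ideal (map f t) (f p) -> in_ideal (u :: t) p.
  elim: t p => [|a t IHt] p /=.
    move=> /in_ideal_nil/ker_f[r ->]; apply/in_ideal_cons; exists r.
    by rewrite subrr; apply: in_ideal0.
  case/in_ideal_cons=> y; have [x <-] := f_onto y.
  rewrite -rmorphM -rmorphB => /IHt/in_ideal_cons[r tr].
  apply/in_ideal_cons; exists r; apply/in_ideal_cons; exists x.
  by rewrite addrAC.
move=> [|i] q lt_i /=.
  by move=> /in_ideal_nil/nzd_u ->; apply: in_ideal0.
move=> /in_ideal_cons[r /(in_ideal_map f)].
rewrite rmorphB !rmorphM fu0 mulr0 subr0 map_take => sq.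
apply: lift_ideal; rewrite map_take; apply: reg_s; first by rewrite size_map.
by rewrite (nth_map 0).
Qed.

(** * Elimination of the first variable *)

Definition elim_tuple (n : nat) (v : {mpoly rat[n]}) : n.+1.-tuple {mpoly rat[n]} :=
  [tuple if unlift ord0 i is Some j then 'X_j else v | i < n.+1].

(** Substituting it is a common section of the substitutions by [elim_tuple v], for all [v]. *)
Definition lift_tuple (n : nat) : n.-tuple {mpoly rat[n.+1]} :=
  [tuple 'X_(lift ord0 i) | i < n].

Lemma comp_elim0 (n : nat) (v : {mpoly rat[n]}) : 'X_ord0 \mPo elim_tuple v = v.
Proof. by rewrite comp_mpolyXU -tnth_nth tnth_mktuple unlift_none. Qed.

Lemma comp_elim_lift (n : nat) (v : {mpoly rat[n]}) (i : 'I_n) :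
  'X_(lift ord0 i) \mPo elim_tuple v = 'X_i.
Proof. by rewrite comp_mpolyXU -tnth_nth tnth_mktuple liftK. Qed.

Lemma comp_lift (n : nat) (i : 'I_n) : 'X_i \mPo lift_tuple n = 'X_(lift ord0 i).
Proof. by rewrite comp_mpolyXU -tnth_nth tnth_mktuple. Qed.

Lemma mpoly_alg_ind (n : nat) (R : nzRingType) (P : {mpoly R[n]} -> Prop) :
  (forall c, P c%:MP) -> (forall i, P 'X_i) ->
  (forall p q, P p -> P q -> P (p + q)) ->
  (forall p q, P p -> P q -> P (p * q)) ->
  forall p, P p.
Proof.
move=> PC PX PD PM; elim/mpolyind=> [|c m p _ _ Pp]; first by rewrite -mpolyC0.
apply: PD Pp; rewrite -mul_mpolyC; apply: (PM) => //.
have P1 : P 1 by rewrite -mpolyC1.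
rewrite mpolyXE_id; apply: (big_ind P) => [||i _]; [exact: P1|exact: PM|].
by elim: (m i) => [|k IHk]; rewrite ?expr0 ?exprS //; apply: PM.
Qed.

Lemma comp_elimK (n : nat) (v p : {mpoly rat[n]}) :
  (p \mPo lift_tuple n) \mPo elim_tuple v = p.
Proof.
elim/mpoly_alg_ind: p => [c|i|p q Ep Eq|p q Ep Eq].
- by rewrite !comp_mpolyC.
- by rewrite comp_lift comp_elim_lift.
- by rewrite !comp_mpolyD Ep Eq.
- by rewrite !rmorphM /= Ep Eq.
Qed.

Lemma comp_elim_ker (n : nat) (v : {mpoly rat[n]}) (p : {mpoly rat[n.+1]}) :
  p \mPo elim_tuple v = 0 <->
  exists r, p = r * ('X_ord0 - (v \mPo lift_tuple n)).
Proof.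
set u := 'X_ord0 - _.
have u0 : u \mPo elim_tuple v = 0.
  by rewrite comp_mpolyB comp_elim0 comp_elimK subrr.
split; last by case=> r ->; rewrite rmorphM /= u0 mulr0.
move=> p0.
(* Vanishing is not inherited by summands or factors; the congruence of any [p] modulo [u] to its
   eliminated and lifted form is, so induction applies to it. *)
suff [r Er] : exists r, p = (p \mPo elim_tuple v) \mPo lift_tuple n + r * u.
  by exists r; rewrite Er p0 comp_mpoly0 add0r.
elim/mpoly_alg_ind: p {p0} => [c|i|p q [r Ep] [t Eq]|p q [r Ep] [t Eq]].
- by exists 0; rewrite !comp_mpolyC mul0r addr0.
- case: (unliftP ord0 i) => [j|] ->.
    by exists 0; rewrite comp_elim_lift comp_lift mul0r addr0.
  by exists 1; rewrite comp_elim0 mul1r addrC subrK.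
- by exists (r + t); rewrite !comp_mpolyD {1}Ep {1}Eq mulrDl addrACA.
- exists (r * q + ((p \mPo elim_tuple v) \mPo lift_tuple n) * t).
  rewrite !rmorphM /= {1}Ep mulrDl {1}Eq mulrDr mulrDl addrAC -addrA.
  by rewrite mulrA mulrAC addrA.
Qed.

Lemma weakly_regular_elim (n : nat) (v : {mpoly rat[n]})
    (s : seq {mpoly rat[n.+1]}) :
  weakly_regular [seq p \mPo elim_tuple v | p <- s] ->
  weakly_regular ('X_ord0 - (v \mPo lift_tuple n) :: s).
Proof.
apply: (weakly_regular_quotient (f := comp_mpoly (elim_tuple v))) => /=.
- by move=> y; exists (y \mPo lift_tuple n); rewrite comp_elimK.
- exact: comp_elim_ker.
move=> q /eqP; rewrite mulf_eq0 => /orP[|/eqP //] /eqP u0.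
(* The linear form takes the value 1 under x_1 := v + 1. *)
have := congr1 (comp_mpoly (elim_tuple (v + 1))) u0.
rewrite comp_mpolyB comp_elim0 comp_elimK comp_mpoly0 addrC addKr => /eqP.
by rewrite oner_eq0.
Qed.

(** * The weighted family and its specialisations *)

(* The bound [b] plays the role of h + 1. *)
Definition wcheck (n : nat) (c : 'I_n -> rat) (b : 'I_n -> nat) (j : 'I_n) :
    {mpoly rat[n]} :=
  \sum_(k < n | (k <= j)%N)
     c k *: ('X_k * \prod_(l < n | (j < l < b j)%N) ('X_k - 'X_l)).

Lemma wcheck_ord0 (n : nat) (c : 'I_n.+1 -> rat) (b : 'I_n.+1 -> nat) :
  wcheck c b ord0 = (c ord0)%:MP *
    ('X_ord0 * \prod_(l < n.+1 | (0 < l < b ord0)%N) ('X_ord0 - 'X_l)).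
Proof.
rewrite /wcheck (bigD1 ord0) //= mul_mpolyC [X in _ + X]big1 ?addr0 //.
by move=> i /andP[]; rewrite leqn0 -val_eqE /= => ->.
Qed.

Definition tail_bound (n : nat) (b : 'I_n.+1 -> nat) (j : 'I_n) : nat :=
  (b (lift ord0 j)).-1.

Lemma comp_elim_wcheck (n : nat) (v : {mpoly rat[n]}) (c : 'I_n.+1 -> rat)
    (b : 'I_n.+1 -> nat) (j : 'I_n) :
  wcheck c b (lift ord0 j) \mPo elim_tuple v =
    c ord0 *: (v * \prod_(l < n | (j < l < tail_bound b j)%N) (v - 'X_l)) +
    wcheck (fun k => c (lift ord0 k)) (tail_bound b) j.
Proof.
have comp_prod k :
    (\prod_(l < n.+1 | (lift ord0 j < l < b (lift ord0 j))%N) ('X_k - 'X_l))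
      \mPo elim_tuple v =
    \prod_(l < n | (j < l < tail_bound b j)%N) ('X_k \mPo elim_tuple v - 'X_l).
  rewrite rmorph_prod big_mkcond big_ord_recl /= mul1r -big_mkcond /=.
  apply: eq_big => [l|l _]; last by rewrite comp_mpolyB comp_elim_lift.
  (* [l.+1 < m] and [l < m.-1] agree even at [m = 0], where both fail. *)
  by rewrite /tail_bound /bump /= !add1n; case: (b _).
rewrite /wcheck raddf_sum big_mkcond big_ord_recl /= -big_mkcond /=.
rewrite comp_mpolyZ rmorphM /= comp_prod comp_elim0; congr (_ + _).
apply: eq_big => // k _.
by rewrite comp_mpolyZ rmorphM /= comp_prod comp_elim_lift.
Qed.

Lemma comp_elim_wcheck0 (n : nat) (c : 'I_n.+1 -> rat) (b : 'I_n.+1 -> nat)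
    (j : 'I_n) :
  wcheck c b (lift ord0 j) \mPo elim_tuple 0 =
  wcheck (fun k => c (lift ord0 k)) (tail_bound b) j.
Proof. by rewrite comp_elim_wcheck mul0r scaler0 add0r. Qed.

Lemma comp_elim_wcheckX (n : nat) (c : 'I_n.+1 -> rat) (b : 'I_n.+1 -> nat)
    (i j : 'I_n) :
  (i < tail_bound b j)%N ->
  wcheck c b (lift ord0 j) \mPo elim_tuple 'X_i =
  wcheck (fun k => c (lift ord0 k) + (if k == i then c ord0 else 0))
    (tail_bound b) j.
Proof.
move=> lt_i; rewrite comp_elim_wcheck addrC /wcheck.
rewrite [RHS](eq_bigr _ (fun k _ => scalerDl _ _ _)) big_split /=.
congr (_ + _); case: (leqP i j) => [le_ij|lt_ji].
  rewrite [RHS](bigD1 i) //= eqxx [X in _ + X]big1 ?addr0 // => k /andP[_ /negPf ->].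
  by rewrite scale0r.
(* Here [j < i < tail_bound b j], so the product contains the factor ['X_i - 'X_i]. The changed
   weight is invisible, as no [k <= j] equals [i]. *)
rewrite [X in _ *: (_ * X)](bigD1 i) ?lt_ji //= subrr mul0r mulr0 scaler0.
rewrite big1 // => k le_kj; rewrite ifN ?scale0r //.
by apply: contraTneq le_kj => ->; rewrite -ltnNge.
Qed.

(** Positivity survives the merging of weights and makes the leading weight a unit at every stage of
    the induction. *)
Lemma wcheck_weakly_regular (n : nat) (c : 'I_n -> rat) (b : 'I_n -> nat) :
  (forall k, 0 < c k) -> (forall i j : 'I_n, (i <= j)%N -> (b i <= b j)%N) ->
  weakly_regular [seq wcheck c b j | j <- enum 'I_n].
Proof.
elim: n c b => [|n IHn] c b c_gt0 b_mono.
  by have /size0nil -> := size_enum_ord 0; case.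
have tb_mono (i j : 'I_n) : (i <= j)%N -> (tail_bound b i <= tail_bound b j)%N.
  by move=> le_ij; rewrite /tail_bound -!subn1 leq_sub2r // b_mono.
rewrite enum_ordSl /= wcheck_ord0 -map_comp.
apply: weakly_regular_mul.
  apply: (@weakly_regular_inv _ _ (c ord0)^-1%:MP).
  by rewrite -mpolyCM mulVf ?mpolyC1 // gt_eqF.
apply: weakly_regular_mul.
  have -> : 'X_ord0 = 'X_ord0 - (0 \mPo lift_tuple n) :> {mpoly rat[n.+1]}.
    by rewrite comp_mpoly0 subr0.
  apply: weakly_regular_elim; rewrite -map_comp.
  by rewrite (eq_map (comp_elim_wcheck0 c b)); apply: IHn.
apply: weakly_regular_prod => l; case: (unliftP ord0 l) => [i|] -> //.
case/andP=> _ lt_i; rewrite -comp_lift; apply: weakly_regular_elim.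
rewrite -map_comp (eq_map (g := wcheck
  (fun k => c (lift ord0 k) + (if k == i then c ord0 else 0)) (tail_bound b))).
  by apply: IHn => // k; case: eqP => _; rewrite ?addr0 ?addr_gt0.
move=> j; apply: comp_elim_wcheckX; rewrite /tail_bound.
(* Monotonicity of [b] carries the bound on [i] from the first member to every later one. *)
have := leq_trans lt_i (b_mono ord0 (lift ord0 j) isT).
by rewrite /= /bump /= add1n; case: (b _).
Qed.

(** * Application to Hessenberg functions *)

Lemma hessenberg_mono (n : nat) (h : 'I_n -> 'I_n) (i j : 'I_n) :
  hessenberg h -> (i <= j)%N -> (h i <= h j)%N.
Proof.
case=> _ h_succ le_ij.
have [d Ed] : exists d, val j = (i + d)%N by exists (j - i)%N; rewrite subnKC.
elim: d j Ed {le_ij} => [|d IHd] j Ed.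
  by rewrite (_ : j = i) //; apply: val_inj; rewrite Ed addn0.
have lt_d : (i + d < n)%N by rewrite (leq_trans _ (ltn_ord j)) // Ed addnS ltnS.
apply: (leq_trans (IHd (Ordinal lt_d) erefl)); apply: h_succ.
by rewrite Ed addnS.
Qed.

Lemma fcheck_wcheck (n : nat) (h : 'I_n -> 'I_n) (j : 'I_n) :
  fcheck (h j) j = wcheck (fun=> 1) (fun j => (h j).+1) j.
Proof. by apply: eq_bigr => k _; rewrite scale1r. Qed.

Lemma fcheck_meval0 (n : nat) (i j : 'I_n) :
  meval (fun=> 0) (fcheck i j) = 0.
Proof.
rewrite /fcheck raddf_sum big1 // => k _.
by rewrite /= mevalM mevalXU mul0r.
Qed.

Theorem lemma6p8 (n : nat) (hn : (0 < n)%N) (h : 'I_n -> 'I_n)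
    (hh : hessenberg h) :
  regular_sequence [seq fcheck (h j) j | j <- enum 'I_n].
Proof.
apply: weakly_regular_sequence.
  rewrite (eq_map (fcheck_wcheck h)); apply: wcheck_weakly_regular => // i j le_ij.
  by rewrite ltnS hessenberg_mono.
(* Evaluation at the origin kills every generator but fixes 1, so 1 is in none of the ideals. *)
move=> i _; rewrite -map_take => /(in_ideal_map (meval (fun=> 0))).
rewrite rmorph1 -map_comp.
rewrite (eq_map (g := fun=> 0)) => [[c]|j]; last exact: fcheck_meval0.
rewrite big1 => [/eqP|k _]; first by rewrite oner_eq0.
(* Positivity of [n] supplies the default index for [nth_map]. *)
by rewrite (nth_map (Ordinal hn)) ?mulr0 //; case: k => k /=; rewrite size_map.
Qed.
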